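(* Consider the multiobjective composite problem $\min_{x\in\mathbb{R}^n} F(x)$ with $F=(F_1,\dots,F_m)$, $F_i=f_i+g_i$, where each $g_i$ is proper, convex and lower semicontinuous and each $f_i:\mathbb{R}^n\to\mathbb{R}$ is twice continuously differentiable (continuous Hessian) and $\mu$-strongly convex for some $\mu>0$. Let $\{x^k\}$ be the (infinite) sequence generated by the Newton-type proximal gradient method described in the context (with parameter $\sigma$), and let $x^*$ be its limit. Then for any $0<\epsilon\le(1-\sigma)\mu$ there exists $K_\epsilon>0$ such that for all $k\ge K_\epsilon$, \[ \|x^{k+1}-x^*\|\le\sqrt{\frac{\epsilon(1+\tau_k^2)}{\mu}}\,\|x^k-x^*\|, \] where $\tau_k:=\frac{\|x^{k+1}-x^k\|}{\|x^k-x^*\|}\in\Big[\frac{\mu-\sqrt{2\mu\epsilon-\epsilon^2}}{\mu-\epsilon},\frac{\mu+\sqrt{2\mu\epsilon-\epsilon^2}}{\mu-\epsilon}\Big]$. Furthermore, $\{x^k\}$ converges superlinearly to $x^*$.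
   Context: Notation: $[m]=\{1,\dots,m\}$. A twice continuously differentiable $h$ is $\mu$-strongly convex if $\mu I\preceq\nabla^2 h(x)$ for all $x$. Newton-type proximal gradient method: for $x\in\mathbb{R}^n$ let $d(x)=\arg\min_{d\in\mathbb{R}^n}\max_{i\in[m]}\{\langle\nabla f_i(x),d\rangle+g_i(x+d)-g_i(x)+\tfrac12\langle d,\nabla^2 f_i(x)d\rangle\}$ and let $\theta(x)$ be the optimal value. Given $x^0$ and $\sigma,\gamma\in(0,1)$, at iteration $k$ compute $d^k=d(x^k)$, $\theta^k=\theta(x^k)$, choose $t_k\in(0,1]$ as the largest element of $\{\gamma^j: j\in\mathbb{N},\ F_i(x^k+\gamma^j d^k)-F_i(x^k)\le \gamma^j\sigma\theta^k\ \forall i\in[m]\}$, and set $x^{k+1}=x^k+t_kd^k$. Standing assumption: the method generates an infinite sequence of points that are not Pareto critical ($d^k\ne0$ for all $k$); under the hypotheses this sequence converges to a Pareto solution $x^*$. *)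

(* Defs.v *)
From HB Require Import structures.
From mathcomp Require Import all_boot all_order all_algebra.
From mathcomp Require Import all_classical all_reals all_analysis.
Set Implicit Arguments. Unset Strict Implicit. Unset Printing Implicit Defensive.
Import Order.TTheory GRing.Theory Num.Theory.
Import numFieldNormedType.Exports.
Local Open Scope classical_set_scope.
Local Open Scope ring_scope.

Section Defs.
Variables (R : realType) (n : nat).
Notation vec := 'rV[R]_n.

Definition dotv (u v : vec) : R := \sum_(i < n) u 0 i * v 0 i.
Definition enorm (u : vec) : R := Num.sqrt (dotv u u).

Definition evec (j : 'I_n) : vec := delta_mx 0 j.

Definition grad (f : vec -> R) (x : vec) : vec :=
  \row_j derive f x (evec j).
Definition hess (f : vec -> R) (x : vec) : 'M[R]_n :=
  \matrix_(i, j) derive (fun y => derive f y (evec j)) x (evec i).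

Definition quad (H : 'M[R]_n) (d : vec) : R :=
  \sum_(i < n) \sum_(j < n) d 0 i * H i j * d 0 j.

Definition twice_cont_diff (f : vec -> R) : Prop :=
  (forall x, differentiable f x) /\
  (forall (j : 'I_n) x, differentiable (fun y => derive f y (evec j)) x) /\
  (forall i j : 'I_n, continuous (fun x => hess f x i j)).

Definition strongly_convex (mu : R) (f : vec -> R) : Prop :=
  forall x d : vec, mu * dotv d d <= quad (hess f x) d.

Definition proper_fun (g : vec -> \bar R) : Prop :=
  (forall x, g x != -oo%E) /\ (exists x, g x \is a fin_num).
Definition convex_fun (g : vec -> \bar R) : Prop :=
  forall (x y : vec) (t : R), 0 < t < 1 ->
    (g (t *: x + (1 - t) *: y)%R <= t%:E * g x + (1 - t)%:E * g y)%E.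
Definition lsc_fun (g : vec -> \bar R) : Prop :=
  forall (x : vec) (a : R), (a%:E < g x)%E -> \forall y \near x, (a%:E < g y)%E.

End Defs.

Section Method.
Variables (R : realType) (n m : nat).
Variables (f : 'I_m -> 'rV[R]_n -> R) (g : 'I_m -> 'rV[R]_n -> \bar R).

Definition Fobj (i : 'I_m) (x : 'rV[R]_n) : \bar R := ((f i x)%:E + g i x)%E.

Definition subobj (x d : 'rV[R]_n) : \bar R :=
  \big[Order.max/-oo%E]_(i < m)
    ((dotv (grad (f i) x) d + 2^-1 * quad (hess (f i) x) d)%:E
      + g i (x + d)%R - g i x)%E.

Definition armijo (sigma gamma : R) (x d : 'rV[R]_n) (theta : \bar R) (j : nat) : Prop :=
  forall i : 'I_m,
    (Fobj i (x + gamma ^+ j *: d)%R - Fobj i x <= (gamma ^+ j * sigma)%:E * theta)%E.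

Definition newton_prox_seq (sigma gamma : R) (x d : nat -> 'rV[R]_n)
    (theta : nat -> \bar R) (t : nat -> R) : Prop :=
  forall k,
    [/\ (forall d', (subobj (x k) (d k) <= subobj (x k) d')%E),
        theta k = subobj (x k) (d k),
        (exists j, [/\ t k = gamma ^+ j, armijo sigma gamma (x k) (d k) (theta k) j &
                     forall j', (j' < j)%N -> ~ armijo sigma gamma (x k) (d k) (theta k) j']) &
        x k.+1 = x k + t k *: d k].
End Method.

(* Main.v *)
(** The subproblem objective is mu-strongly convex, so its optimal value theta
    satisfies theta + mu/2 |d' - d|^2 <= max_i (model_i at d') for every d'; at
    d' = 0 this gives theta <= - mu/2 |d|^2.  By continuity of the Hessians, near
    xstar the second order models of the f_i are exact up to eps/2 |h|^2.  Any step
    in (0, 1] staying in that neighbourhood passes the Armijo test as soon as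
    eps <= (1 - sigma) mu, which forces unit steps eventually.  Along the iterates
    every F_i decreases, and by lower semicontinuity F_i xstar is a lower bound.
    Testing strong convexity at d' = xstar - x k then yields
    mu |x k.+1 - xstar|^2 <= eps (|x k - xstar|^2 + |x k.+1 - x k|^2),
    from which the rate, the bounds on tau (by the triangle inequality) and the
    superlinear convergence are elementary. *)
Require Import Defs.
From HB Require Import structures.
From mathcomp Require Import all_boot all_order all_algebra.
From mathcomp Require Import all_classical all_reals all_analysis.
From mathcomp Require Import ring lra.
Set Implicit Arguments. Unset Strict Implicit. Unset Printing Implicit Defensive.
Import Order.TTheory GRing.Theory Num.Theory.
Import numFieldNormedType.Exports.
Local Open Scope classical_set_scope.
Local Open Scope ring_scope.

(** * Euclidean inner product and norm *)

Lemma dotvC (R : realType) n (u v : 'rV[R]_n) : dotv u v = dotv v u.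
Proof. by apply: eq_bigr => i _; rewrite mulrC. Qed.

Lemma dotvDl (R : realType) n (u v w : 'rV[R]_n) :
  dotv (u + v) w = dotv u w + dotv v w.
Proof. by rewrite /dotv -big_split; apply: eq_bigr => i _; rewrite mxE mulrDl. Qed.

Lemma dotvDr (R : realType) n (u v w : 'rV[R]_n) :
  dotv u (v + w) = dotv u v + dotv u w.
Proof. by rewrite dotvC dotvDl !(dotvC u). Qed.

Lemma dotvZl (R : realType) n (a : R) (u v : 'rV[R]_n) :
  dotv (a *: u) v = a * dotv u v.
Proof. by rewrite /dotv mulr_sumr; apply: eq_bigr => i _; rewrite mxE mulrA. Qed.

Lemma dotvZr (R : realType) n (a : R) (u v : 'rV[R]_n) :
  dotv u (a *: v) = a * dotv u v.
Proof. by rewrite dotvC dotvZl dotvC. Qed.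

Lemma dotvNN (R : realType) n (u v : 'rV[R]_n) : dotv (- u) (- v) = dotv u v.
Proof. by apply: eq_bigr => i _; rewrite !mxE mulrNN. Qed.

Lemma dotv_ge0 (R : realType) n (u : 'rV[R]_n) : 0 <= dotv u u.
Proof. by apply: sumr_ge0 => i _; rewrite -expr2 sqr_ge0. Qed.

Lemma dotv_eq0 (R : realType) n (u : 'rV[R]_n) : (dotv u u == 0) = (u == 0).
Proof.
apply/eqP/eqP => [u0|->]; last by apply: big1 => i _; rewrite mxE mul0r.
apply/rowP => i; rewrite mxE.
have u_ge0 j : true -> 0 <= u 0 j * u 0 j by rewrite -expr2 sqr_ge0.
by apply/eqP; rewrite -sqrf_eq0 expr2 (psumr_eq0P u_ge0 u0).
Qed.

Lemma dotv_gt0 (R : realType) n (u : 'rV[R]_n) : (0 < dotv u u) = (u != 0).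
Proof. by rewrite lt_def dotv_ge0 andbT dotv_eq0. Qed.

Lemma sqr_enorm (R : realType) n (u : 'rV[R]_n) : enorm u ^+ 2 = dotv u u.
Proof. by rewrite sqr_sqrtr// dotv_ge0. Qed.

Lemma enorm_ge0 (R : realType) n (u : 'rV[R]_n) : 0 <= enorm u.
Proof. exact: sqrtr_ge0. Qed.

Lemma enorm_gt0 (R : realType) n (u : 'rV[R]_n) : (0 < enorm u) = (u != 0).
Proof. by rewrite sqrtr_gt0 dotv_gt0. Qed.

Lemma ler_coord_enorm (R : realType) n (u : 'rV[R]_n) i : `|u 0 i| <= enorm u.
Proof.
rewrite -sqrtr_sqr ler_sqrt ?dotv_ge0// /dotv (bigD1 i)//= -expr2 lerDl.
by apply: sumr_ge0 => j _; rewrite -expr2 sqr_ge0.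
Qed.

(** The ambient norm on row vectors is the max norm. This comparison carries Euclidean convergence
    over to the topology in which continuity and semicontinuity are stated. *)
Lemma ler_norm_enorm (R : realType) n (u : 'rV[R]_n) : `|u| <= enorm u.
Proof.
rewrite [leLHS]mx_normrE; apply: bigmax_le => [|[a i] _ /=]; first exact: enorm_ge0.
by rewrite ord1 ler_coord_enorm.
Qed.

Lemma sqr_enormB_le (R : realType) n (u v : 'rV[R]_n) :
  (enorm u - enorm v) ^+ 2 <= dotv (u - v) (u - v).
Proof.
have cs : dotv u v <= enorm u * enorm v.
  have [->|u0] := eqVneq u 0.
    by rewrite /dotv big1 ?mulr_ge0 ?enorm_ge0// => i _; rewrite mxE mul0r.
  have [->|v0] := eqVneq v 0.
    by rewrite /dotv big1 ?mulr_ge0 ?enorm_ge0// => i _; rewrite mxE mulr0.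
  have uv0 : 0 < enorm u * enorm v by rewrite mulr_gt0 ?enorm_gt0.
  (* Cauchy-Schwarz: expanding this square and dividing by [2 * enorm u * enorm v] leaves the claim,
     hence the separate treatment of zero vectors. *)
  have := dotv_ge0 (enorm v *: u - enorm u *: v).
  rewrite -scaleNr !(dotvDl, dotvDr, dotvZl, dotvZr) (dotvC v u) -!sqr_enorm => h.
  rewrite -(ler_pM2l uv0); nra.
rewrite -(scaleN1r v) !(dotvDl, dotvDr, dotvZl, dotvZr) (dotvC v u) -!sqr_enorm; nra.
Qed.

(** * Quadratic forms of matrices *)

Lemma quadZ (R : realType) n (H : 'M[R]_n) (a : R) (u : 'rV[R]_n) :
  quad H (a *: u) = a ^+ 2 * quad H u.
Proof.
rewrite /quad mulr_sumr; apply: eq_bigr => i _; rewrite mulr_sumr.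
by apply: eq_bigr => j _; rewrite !mxE; ring.
Qed.

(** Both sides carry the same cross terms, so symmetry of [H] is not assumed. The subtracted term is
    the source of strong convexity of the models. *)
Lemma quad_convex_comb (R : realType) n (H : 'M[R]_n) (s : R) (u v : 'rV[R]_n) :
  quad H (s *: u + (1 - s) *: v) =
  s * quad H u + (1 - s) * quad H v - s * (1 - s) * quad H (u - v).
Proof.
rewrite /quad !mulr_sumr -!(big_split, sumrB) /=; apply: eq_bigr => i _.
rewrite !mulr_sumr -!(big_split, sumrB) /=; apply: eq_bigr => j _.
by rewrite !mxE; ring.
Qed.

Lemma quad_sub_le (R : realType) n (H K : 'M[R]_n) (e : R) (u : 'rV[R]_n) :
  (forall i j, `|H i j - K i j| <= e) ->
  `|quad H u - quad K u| <= (n * n)%:R * e * dotv u u.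
Proof.
move=> HK.
have e_term i j : `|u 0 i * H i j * u 0 j - u 0 i * K i j * u 0 j| <= e * dotv u u.
  have -> : u 0 i * H i j * u 0 j - u 0 i * K i j * u 0 j =
            (H i j - K i j) * (u 0 i * u 0 j) by ring.
  rewrite normrM ler_pM// normrM -sqr_enorm expr2.
  by rewrite ler_pM// ler_coord_enorm.
rewrite /quad -sumrB; under eq_bigr do rewrite -sumrB.
have -> : (n * n)%:R * e * dotv u u = \sum_(i < n) \sum_(j < n) e * dotv u u.
  by rewrite !sumr_const !card_ord -mulrnA -mulrA mulr_natl.
apply: le_trans (ler_norm_sum _ _ _) _; apply: ler_sum => i _.
by apply: le_trans (ler_norm_sum _ _ _) _; apply: ler_sum => j _.
Qed.

(** * Taylor expansion to second order along segments *)

Lemma derive_coord_sum (R : realType) n (f : 'rV[R]_n -> R) (x h : 'rV[R]_n) :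
  differentiable f x -> derive f x h = \sum_(j < n) h 0 j * derive f x (evec R j).
Proof.
move=> df; rewrite deriveE// [in LHS](row_sum_delta h) linear_sum.
by apply: eq_bigr => j _; rewrite linearZ deriveE.
Qed.

Lemma is_derive_line (R : realType) n (f : 'rV[R]_n -> R) (x h : 'rV[R]_n) (s : R) :
  differentiable f (x + s *: h) ->
  is_derive s (1 : R) (fun r : R => f (x + r *: h)) (derive f (x + s *: h) h).
Proof.
move=> df.
have E : (fun r : R => r^-1 *: (((fun r : R => f (x + r *: h)) \o shift s) (r *: (1 : R))
            - f (x + s *: h))) =
         (fun r : R => r^-1 *: ((f \o shift (x + s *: h)) (r *: h) - f (x + s *: h))).
  by apply/funext => r /=; rewrite scaler1 scalerDl addrCA.
split; rewrite /derivable /derive E //.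
exact: (diff_derivable df).
Qed.

(** Only pointwise existence of [ddp] is assumed, so the mean value theorem is applied twice, to [u]
    and then to [dp], instead of integrating. *)
Lemma second_order_upper (R : realType) (p dp ddp : R -> R) (M : R) :
  (forall s : R, is_derive s (1 : R) p (dp s)) ->
  (forall s : R, is_derive s (1 : R) dp (ddp s)) ->
  (forall s, 0 <= s <= 1 -> ddp s <= M) ->
  p 1 - p 0 - dp 0 <= M / 2.
Proof.
move=> Dp Ddp leM.
have contw (u du : R -> R) (a b : R) : (forall s : R, is_derive s (1 : R) u (du s)) ->
    {within `[a, b], continuous u}.
  by move=> Du; apply: derivable_within_continuous => s _; case: (Du s).
(* [u] is [p] minus its Taylor parabola with [ddp] replaced by [M]; its derivative is nonpositive. *)
pose u : R -> R := p - (dp 0 \*: id) - ((M / 2) \*: (id ^+ 2)).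
pose du (s : R) : R := dp s - dp 0 - M * s.
have Du (s : R) : is_derive s (1 : R) u (du s).
  rewrite /u; apply: is_derive_eq.
  by rewrite /du /= /GRing.scale /=; field.
have [c] := MVT_segment ler01 (fun s _ => Du s) (contw _ _ 0 1 Du).
rewrite in_itv /= => /andP[c0 c1].
have [c'] := MVT_segment c0 (fun s _ => Ddp s) (contw _ _ 0 c Ddp).
rewrite in_itv /= => /andP[c'0 c'c] E1.
have E2 : u 1 - u 0 = p 1 - p 0 - dp 0 - M / 2.
  by rewrite /u !fctE /= /GRing.scale /=; field.
rewrite E2 /du E1 subr0 => E3.
have := leM c'; rewrite c'0 (le_trans c'c c1) => /(_ isT) h.
rewrite -subr_le0 E3 subr0 mulr1 -mulrBl.
by rewrite mulr_le0_ge0// subr_le0.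
Qed.

Definition newton_model (R : realType) n (f : 'rV[R]_n -> R) (x h : 'rV[R]_n) : R :=
  dotv (grad f x) h + 2^-1 * quad (hess f x) h.

(** Along the segment the one-sided Taylor bound is applied to [p] and to [- p], which gives both
    halves of the absolute value. *)
Lemma newton_model_error (R : realType) n (f : 'rV[R]_n -> R) (x h : 'rV[R]_n) (e : R) :
  twice_cont_diff f ->
  (forall s, 0 <= s <= 1 -> `|quad (hess f (x + s *: h)) h - quad (hess f x) h| <= e) ->
  `|f (x + h) - f x - newton_model f x h| <= e / 2.
Proof.
move=> [df [ddf _]] He.
pose p (s : R) := f (x + s *: h).
pose dp (s : R) := derive f (x + s *: h) h.
pose ddp (s : R) := quad (hess f (x + s *: h)) h.
have Dp (s : R) : is_derive s (1 : R) p (dp s) by apply: is_derive_line.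
have Ddp (s : R) : is_derive s (1 : R) dp (ddp s).
  have -> : dp = \sum_(j < n) (h 0 j \*: (fun r : R => derive f (x + r *: h) (evec R j))).
    by apply/funext => r; rewrite /dp derive_coord_sum// fct_sumE.
  have -> : ddp s = \sum_(j < n)
      h 0 j *: derive (fun y => derive f y (evec R j)) (x + s *: h) h.
    rewrite /ddp /quad exchange_big; apply: eq_bigr => j _.
    rewrite derive_coord_sum// /GRing.scale /= mulr_sumr.
    by apply: eq_bigr => i _; rewrite mxE; ring.
  apply: is_derive_sum => j; apply: is_deriveZ.
  exact: (is_derive_line (ddf j _)).
have dp0 : dp 0 = dotv (grad f x) h.
  rewrite /dp scale0r addr0 derive_coord_sum//.
  by apply: eq_bigr => j _; rewrite mxE mulrC.
have ddp_near s : 0 <= s <= 1 -> `|ddp s - quad (hess f x) h| <= e by move=> /He.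
have upper : p 1 - p 0 - dp 0 <= (quad (hess f x) h + e) / 2.
  apply: (second_order_upper Dp Ddp) => s /ddp_near.
  rewrite ler_norml => /andP[_].
  by rewrite lerBlDr addrC.
have lower : - p 1 - - p 0 - - dp 0 <= (e - quad (hess f x) h) / 2.
  apply: (second_order_upper (fun s => is_deriveN (Dp s)) (fun s => is_deriveN (Ddp s))).
  move=> s /ddp_near.
  rewrite ler_norml => /andP[+ _]; change ((- ddp) s) with (- ddp s).
  by rewrite lerBrDr (lerNl (ddp s)) opprB addrC.
move: upper lower; rewrite dp0 /p scale1r scale0r addr0 /newton_model.
by rewrite ler_norml; lra.
Qed.

(** Only finitely many Hessian entries occur over all [i], so one radius serves them all; the ball
    is convex, so it contains the whole segment from [x] to [x + h]. *)
Lemma newton_model_error_near (R : realType) n m (f : 'I_m -> 'rV[R]_n -> R)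
    (c : 'rV[R]_n) (e : R) :
  (forall i, twice_cont_diff (f i)) -> 0 < e ->
  exists2 r : R, 0 < r & forall i x h, `|x - c| < r -> `|x + h - c| < r ->
    `|f i (x + h) - f i x - newton_model (f i) x h| <= e / 2 * dotv h h.
Proof.
move=> tf e0.
(* Two Hessians are compared through the one at [c], which costs [2 * (n * n) * e'], at most [e].
   The successor keeps the divisor nonzero when [n = 0]. *)
pose e' : R := e / 2 / (n * n).+1%:R.
have e'0 : 0 < e' by rewrite !divr_gt0.
have : \forall y \near c, forall p : 'I_m * ('I_n * 'I_n),
    `|hess (f p.1) y p.2.1 p.2.2 - hess (f p.1) c p.2.1 p.2.2| < e'.
  pose near_entry (p : 'I_m * ('I_n * 'I_n)) : set 'rV[R]_n := [set y |
    `|hess (f p.1) y p.2.1 p.2.2 - hess (f p.1) c p.2.1 p.2.2| < e'].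
  have near_entryP p : \forall y \near c, near_entry p y.
    have [_ [_ cH]] := tf p.1.
    exact: (cvgr_distC_lt _ _ (cH p.2.1 p.2.2 c) _ e'0).
  exact: (@filter_forall _ _ near_entry (nbhs c) _ near_entryP).
move=> /nbhs_ballP[r r0 hr]; exists r => // i x h xr xhr.
have near_hess y : `|y - c| < r -> forall a b, `|hess (f i) y a b - hess (f i) c a b| <= e'.
  by move=> yr a b; apply/ltW/(hr y _ (i, (a, b))); rewrite -ball_normE /= distrC.
rewrite mulrAC; apply: newton_model_error => // s /andP[s0 s1].
have le_e : e = e' + e' + 2 * (n * n)%:R * e'.
  have : e' * (n * n).+1%:R = e / 2 by rewrite divfK// pnatr_eq0.
  by rewrite -natr1; lra.
have sr : `|x + s *: h - c| < r.
  have -> : x + s *: h - c = s *: (x + h - c) + (1 - s) *: (x - c).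
    by apply/rowP => j; rewrite !mxE; ring.
  apply: le_lt_trans (ler_normD _ _) _.
  rewrite !normrZ (ger0_norm s0) (@ger0_norm _ (1 - s)) ?subr_ge0//.
  have [->|sN1] := eqVneq s 1; first by rewrite subrr mul0r addr0 mul1r.
  have : 0 < 1 - s by rewrite subr_gt0 lt_neqAle sN1.
  nra.
have q1 := quad_sub_le h (near_hess _ sr).
have q2 := quad_sub_le h (near_hess _ xr).
have -> : quad (hess (f i) (x + s *: h)) h - quad (hess (f i) x) h =
  (quad (hess (f i) (x + s *: h)) h - quad (hess (f i) c) h) -
  (quad (hess (f i) x) h - quad (hess (f i) c) h).
  by rewrite opprB addrA subrK.
apply: le_trans (ler_normB _ _) _; apply: le_trans (lerD q1 q2) _.
rewrite -mulrDl; apply: ler_wpM2r; first exact: dotv_ge0.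
by move: e'0; rewrite {}le_e; clear; clearbody e'; lra.
Qed.

(** * Strong convexity of the subproblem *)

Lemma convex_fun_fine (R : realType) n (g : 'rV[R]_n -> \bar R) (u v : 'rV[R]_n) (s : R) :
  proper_fun g -> convex_fun g -> g u \is a fin_num -> g v \is a fin_num ->
  0 < s < 1 ->
  g (s *: u + (1 - s) *: v) \is a fin_num /\
  fine (g (s *: u + (1 - s) *: v)) <= s * fine (g u) + (1 - s) * fine (g v).
Proof.
move=> [gNy _] cg gu gv s01; have := cg u v s s01.
have := gNy (s *: u + (1 - s) *: v).
by case: (g u) gu => [a| |]//; case: (g v) gv => [b| |]//; case: (g _).
Qed.

Lemma newton_model0 (R : realType) n (f : 'rV[R]_n -> R) (x : 'rV[R]_n) :
  newton_model f x 0 = 0.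
Proof. by rewrite /newton_model -[0 in LHS](scale0r 0) dotvZr quadZ expr0n !mul0r mulr0 addr0. Qed.

Lemma newton_modelZ (R : realType) n (f : 'rV[R]_n -> R) (x h : 'rV[R]_n) (s : R) :
  newton_model f x (s *: h) =
  s * newton_model f x h - s * (1 - s) / 2 * quad (hess f x) h.
Proof. by rewrite /newton_model dotvZr quadZ; field. Qed.

Lemma newton_model_convex_comb (R : realType) n (f : 'rV[R]_n -> R) (mu : R)
    (x u v : 'rV[R]_n) (s : R) :
  strongly_convex mu f -> 0 < s < 1 ->
  newton_model f x (s *: u + (1 - s) *: v) <=
  s * newton_model f x u + (1 - s) * newton_model f x v
  - s * (1 - s) * (mu / 2 * dotv (u - v) (u - v)).
Proof.
move=> /(_ x (u - v)) sc /andP[s0 s1].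
rewrite /newton_model quad_convex_comb (dotvDr (grad f x)) !dotvZr.
have : 0 <= s * (1 - s) * (quad (hess f x) (u - v) - mu * dotv (u - v) (u - v)).
  by rewrite !mulr_ge0 ?subr_ge0// ltW.
move: (quad _ _) (quad _ _) (quad _ _) (dotv _ _) (dotv _ _) (dotv _ _) => {sc} *.
lra.
Qed.

(** This trades the extended-real maximum for real inequalities: [b] is any common bound on the
    terms at [d']. The last clause is quadratic growth away from the minimizer. *)
Lemma subobj_minimizer (R : realType) n m (f : 'I_m -> 'rV[R]_n -> R)
    (g : 'I_m -> 'rV[R]_n -> \bar R) (mu : R) (x d : 'rV[R]_n) :
  (0 < m)%N -> (forall i, proper_fun (g i)) -> (forall i, convex_fun (g i)) ->
  (forall i, strongly_convex mu (f i)) -> 0 < mu ->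
  (forall i, g i x \is a fin_num) ->
  (forall d', (subobj f g x d <= subobj f g x d')%E) ->
  exists th : R, [/\ subobj f g x d = th%:E,
    forall i, g i (x + d) \is a fin_num,
    forall i, newton_model (f i) x d + fine (g i (x + d)) - fine (g i x) <= th &
    forall d' b, (forall i, g i (x + d') \is a fin_num) ->
      (forall i, newton_model (f i) x d' + fine (g i (x + d')) - fine (g i x) <= b) ->
      th + mu / 2 * dotv (d' - d) (d' - d) <= b].
Proof.
move=> m0 pg cg sc mu0 gx dmin.
have term_le y i : ((newton_model (f i) x y)%:E + g i (x + y)%R - g i x <= subobj f g x y)%E.
  exact: (le_bigmax _ (fun i => ((newton_model (f i) x y)%:E + g i (x + y)%R - g i x)%E)).
have termE y i : g i (x + y) \is a fin_num ->
    ((newton_model (f i) x y)%:E + g i (x + y)%R - g i x)%E =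
    (newton_model (f i) x y + fine (g i (x + y)) - fine (g i x))%:E.
  by move=> gy; rewrite [RHS]EFinB [in RHS]EFinD !fineK.
have sub_le y b : (forall i, g i (x + y) \is a fin_num) ->
    (forall i, newton_model (f i) x y + fine (g i (x + y)) - fine (g i x) <= b) ->
    (subobj f g x y <= b%:E)%E.
  move=> gy le_b; apply: bigmax_le => [|i _]; first exact: leNye.
  by rewrite -/(newton_model (f i) x y) termE// lee_fin.
have sub_le0 : (subobj f g x d <= 0%:E)%E.
  apply: le_trans (dmin 0) _; apply: sub_le => i; rewrite addr0//.
  by rewrite newton_model0 add0r subrr.
(* The value at [d' = 0] bounds the minimum by 0, so no term at [d] can be [+oo]. *)
have gxd i : g i (x + d) \is a fin_num.
  have := le_trans (term_le d i) sub_le0; have [/(_ (x + d)) + _] := pg i.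
  by case: (g i (x + d)) => //; case: (g i x) (gx i).
have i0 : 'I_m := Ordinal m0.
(* As [m] is positive, one real term lies below the maximum, which rules out [-oo]. *)
have [th thE] : exists th : R, subobj f g x d = th%:E.
  move: (term_le d (Ordinal m0)) sub_le0; rewrite termE//.
  by case: (subobj _ _ _ _) => [r| |]//; exists r.
exists th; split => // [i|d' b gd' le_b].
  by rewrite -lee_fin -thE -termE.
set D := dotv _ _.
have D0 : 0 <= D := dotv_ge0 _.
(* Test minimality against the convex combination of [d'] and [d], then let s -> 0. *)
have th_le s : 0 < s < 1 -> th <= b - (1 - s) * (mu / 2 * D).
  move=> s01; have /andP[s0 s1] := s01.
  have xs : x + (s *: d' + (1 - s) *: d) = s *: (x + d') + (1 - s) *: (x + d).
    by apply/rowP => j; rewrite !mxE; ring.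
  rewrite -(ler_pM2l s0).
  suff : th <= s * b + (1 - s) * th - s * (1 - s) * (mu / 2 * D) by lra.
  rewrite -lee_fin -thE; apply: le_trans (dmin (s *: d' + (1 - s) *: d)) _.
  apply: sub_le => i; rewrite xs.
    by have [] := convex_fun_fine (pg i) (cg i) (gd' i) (gxd i) s01.
  have [_] := convex_fun_fine (pg i) (cg i) (gd' i) (gxd i) s01.
  have := newton_model_convex_comb x d' d (sc i) s01; rewrite -/D.
  have : newton_model (f i) x d + fine (g i (x + d)) - fine (g i x) <= th.
    by rewrite -lee_fin -thE -termE.
  move/(ler_wpM2l (ltW (_ : 0 < 1 - s))); rewrite subr_gt0 => /(_ s1).
  move: (le_b i) => /(ler_wpM2l (ltW s0)).
  move: (newton_model _ _ _) (newton_model _ _ _) (newton_model _ _ _).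
  move: (fine _) (fine _) (fine _) (fine _) => *.
  lra.
set c := mu / 2 * D in th_le *.
have c0 : 0 <= c by rewrite mulr_ge0// divr_ge0// ltW.
rewrite leNgt; apply/negP => b_lt.
pose e := th + c - b.
have e0 : 0 < e by rewrite subr_gt0.
have ec : 0 < e + c + 1 by lra.
(* [th_le] says [e <= s * c] for every [s] in (0, 1); this value of [s] would force
   [e + c + 1 <= c]. *)
have := th_le (e / (e + c + 1)); rewrite divr_gt0// ltr_pdivrMr// mul1r.
have -> : (e < e + c + 1) = true by apply/idP; lra.
move=> /(_ isT) h.
have : e <= e / (e + c + 1) * c by move: h; rewrite /e; lra.
rewrite mulrAC ler_pdivlMr// ler_pM2l//; lra.
Qed.

(** * Decrease of the objectives along a step and at the limit *)

Lemma convex_fun_step (R : realType) n (g : 'rV[R]_n -> \bar R) (x d : 'rV[R]_n) (s : R) :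
  proper_fun g -> convex_fun g -> g x \is a fin_num -> g (x + d) \is a fin_num ->
  0 < s <= 1 ->
  g (x + s *: d) \is a fin_num /\
  fine (g (x + s *: d)) - fine (g x) <= s * (fine (g (x + d)) - fine (g x)).
Proof.
move=> pg cg gx gxd /andP[s0 s1].
(* [convex_fun] covers only 0 < s < 1, while unit steps matter here. *)
have [->|sN1] := eqVneq s 1; first by rewrite scale1r mul1r.
have s01 : 0 < s < 1 by rewrite s0 lt_neqAle sN1.
have -> : x + s *: d = s *: (x + d) + (1 - s) *: x.
  by apply/rowP => j; rewrite !mxE; ring.
have [-> h] := convex_fun_fine pg cg gxd gx s01; split=> //.
by rewrite mulrBr; lra.
Qed.

(** Convexity bounds the change by [s * th] plus the model error [e / 2 * s ^+ 2 * dotv d d]. The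
    Armijo slack [(1 - sigma) * s * th] is negative enough to absorb that error, since
    [e <= (1 - sigma) * mu] and [s <= 1]. *)
Lemma sufficient_decrease (R : realType) n (f : 'rV[R]_n -> R) (g : 'rV[R]_n -> \bar R)
    (mu sigma e th s : R) (x d : 'rV[R]_n) :
  proper_fun g -> convex_fun g -> strongly_convex mu f -> 0 <= mu ->
  g x \is a fin_num -> g (x + d) \is a fin_num ->
  newton_model f x d + fine (g (x + d)) - fine (g x) <= th ->
  th <= - (mu / 2 * dotv d d) ->
  0 <= e <= (1 - sigma) * mu -> sigma <= 1 -> 0 < s <= 1 ->
  `|f (x + s *: d) - f x - newton_model f x (s *: d)| <= e / 2 * dotv (s *: d) (s *: d) ->
  f (x + s *: d) + fine (g (x + s *: d)) - (f x + fine (g x)) <= s * sigma * th.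
Proof.
move=> pg cg sc mu0 gx gxd le_th th_le /andP[e0 e_le] sigma1 s01.
have [_ g_le] := convex_fun_step pg cg gx gxd s01; have /andP[s0 s1] := s01.
rewrite newton_modelZ dotvZl dotvZr ler_norml => /andP[_].
have D0 := dotv_ge0 d.
have Q0 : 0 <= quad (hess f x) d by apply: le_trans (sc x d); rewrite mulr_ge0.
move: (quad _ _) (dotv _ _) (newton_model _ _ _) (f (x + s *: d)) (f x)
  (fine (g (x + s *: d))) (fine (g (x + d))) (fine (g x))
  D0 Q0 le_th th_le g_le => Q D M fs f0 gs gd g0 D0 Q0 le_th th_le g_le f_le.
have h1 : 0 <= s * (1 - s) / 2 * Q by rewrite !mulr_ge0 ?invr_ge0 ?subr_ge0// ltW.
have h2 : e / 2 * (s * (s * D)) <= s * ((1 - sigma) * (mu / 2 * D)).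
  have h3 : s * D <= D by rewrite ler_piMl.
  have h4 : e * (s * D) <= (1 - sigma) * mu * D.
    by apply: ler_pM => //; rewrite mulr_ge0// ltW.
  have := ler_wpM2l (ltW s0) h4; lra.
have h3 : s * ((1 - sigma) * th) <= s * ((1 - sigma) * - (mu / 2 * D)).
  by rewrite ler_pM2l// ler_wpM2l// subr_ge0.
have h4 : s * (M + gd - g0) <= s * th by rewrite ler_pM2l.
lra.
Qed.

(** Were [g c] larger than [b - f c], a level [a] strictly between them would eventually lie below
    [g (x k)], against the bound once [f (x k)] is close to [f c]. Finiteness of [g c] comes
    along. *)
Lemma lsc_limit_le (R : realType) n (f : 'rV[R]_n -> R) (g : 'rV[R]_n -> \bar R)
    (x : nat -> 'rV[R]_n) (c : 'rV[R]_n) (b : R) :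
  proper_fun g -> lsc_fun g -> {for c, continuous f} -> x @ \oo --> c ->
  (forall k, g (x k) \is a fin_num) ->
  (\forall k \near \oo, f (x k) + fine (g (x k)) <= b) ->
  g c \is a fin_num /\ f c + fine (g c) <= b.
Proof.
move=> [gNy _] lg cf xc gx le_b.
suff : (g c <= (b - f c)%:E)%E.
  by have := gNy c; case: (g c) => // r _; rewrite lee_fin => ?; split => //=; lra.
rewrite leNgt; apply/negP => lt_g.
have [a a_gt lt_a] : exists2 a : R, b - f c < a & (a%:E < g c)%E.
  case: (g c) lt_g => [r| |] //.
    rewrite lte_fin => h; exists ((b - f c + r) / 2); rewrite ?lte_fin; lra.
  by move=> _; exists (b - f c + 1); rewrite ?ltry//; lra.
have e0 : 0 < a - (b - f c) by rewrite subr_gt0.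
have near_g : \forall k \near \oo, (a%:E < g (x k))%E := xc _ (lg c a lt_a).
have near_f : \forall k \near \oo, `|f c - f (x k)| < a - (b - f c).
  exact: (cvgr_dist_lt _ _ (cvg_comp _ _ xc cf) _ e0).
have [k [[]]] := @filter_ex _ \oo _ _ (filterI (filterI near_g near_f) le_b).
have := gx k; case: (g (x k)) => // r _; rewrite lte_fin ltr_norml /= => ? /andP[? ?] ?.
by clear lt_g lt_a; lra.
Qed.

(** * Norm convergence and the scalar rate inequalities *)

Lemma cvg_enorm (R : realType) n (x : nat -> 'rV[R]_n) (c : 'rV[R]_n) :
  (fun k => enorm (x k - c)) @ \oo --> (0 : R) -> x @ \oo --> c.
Proof.
move=> xc; apply/cvgrPdist_lt => e e0.
apply: filterS (cvgr0_norm_lt _ xc _ e0) => k; rewrite ger0_norm ?enorm_ge0// distrC.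
exact/le_lt_trans/ler_norm_enorm.
Qed.

(** [S], [P] and [T] stand for the old error, the new error and the step length. The rate is the
    square root of the first estimate; inserting [(T - S) ^+ 2 <= P ^+ 2] into it confines
    [T / S]. *)
Lemma ratio_bounds (R : realType) (mu e S P T : R) :
  0 < mu -> 0 < e < mu -> 0 < S -> 0 <= P ->
  mu * P ^+ 2 <= e * (S ^+ 2 + T ^+ 2) -> (T - S) ^+ 2 <= P ^+ 2 ->
  P <= Num.sqrt (e * (1 + (T / S) ^+ 2) / mu) * S /\
  (mu - Num.sqrt (2 * mu * e - e ^+ 2)) / (mu - e) <= T / S
    <= (mu + Num.sqrt (2 * mu * e - e ^+ 2)) / (mu - e).
Proof.
move=> mu0 /andP[e0 e_lt] S0 P0 est tri.
set tau := T / S; have TE : T = tau * S by rewrite /tau divfK// gt_eqF.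
move: tau TE => tau TE; rewrite {T}TE in est tri *.
have mue : 0 < mu - e by rewrite subr_gt0.
split.
  rewrite -[leLHS](ger0_norm P0) -sqrtr_sqr -[S in leRHS](ger0_norm (ltW S0)) -sqrtr_sqr.
  rewrite -sqrtrM; last by rewrite divr_ge0 ?mulr_ge0 ?addr_ge0 ?sqr_ge0// ltW.
  rewrite ler_wsqrtr// mulrAC ler_pdivlMr// mulrC; nra.
(* [T / S] satisfies (mu - e) tau^2 - 2 mu tau + (mu - e) <= 0; complete the square. *)
have quad_le : ((mu - e) * tau - mu) ^+ 2 <= 2 * mu * e - e ^+ 2.
  have : mu * (tau - 1) ^+ 2 <= e * (1 + tau ^+ 2).
    rewrite -(@ler_pM2r _ (S ^+ 2)) ?exprn_gt0//.
    apply: le_trans (_ : mu * P ^+ 2 <= _); last by apply: le_trans est _; lra.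
    by rewrite -mulrA ler_pM2l//; apply: le_trans tri; lra.
  move/(ler_wpM2l (ltW mue)); lra.
have := ler_wsqrtr quad_le; rewrite sqrtr_sqr ler_norml => /andP[lo hi].
by rewrite ler_pdivrMr// ler_pdivlMr//; apply/andP; split; lra.
Qed.

(** * Unit steps, the key estimate and the convergence rates *)

Theorem theorem4 (R : realType) (n m : nat)
    (f : 'I_m -> 'rV[R]_n -> R) (g : 'I_m -> 'rV[R]_n -> \bar R) (mu : R)
    (sigma gamma : R) (x d : nat -> 'rV[R]_n) (theta : nat -> \bar R)
    (t : nat -> R) (xstar : 'rV[R]_n) :
  (0 < m)%N ->
  (forall i, proper_fun (g i)) -> (forall i, convex_fun (g i)) ->
  (forall i, lsc_fun (g i)) ->
  (forall i, twice_cont_diff (f i)) ->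
  0 < mu -> (forall i, strongly_convex mu (f i)) ->
  0 < sigma < 1 -> 0 < gamma < 1 ->
  (forall i, g i (x 0%N) \is a fin_num) ->
  newton_prox_seq f g sigma gamma x d theta t ->
  (forall k, d k != 0) ->
  (fun k => enorm (x k - xstar)) @ \oo --> (0 : R) ->
  (forall eps : R, 0 < eps <= (1 - sigma) * mu ->
    exists Keps : nat, (0 < Keps)%N /\
      forall k, (Keps <= k)%N ->
        let tau := enorm (x k.+1 - x k) / enorm (x k - xstar) in
        enorm (x k.+1 - xstar)
          <= Num.sqrt (eps * (1 + tau ^+ 2) / mu) * enorm (x k - xstar) /\
        (mu - Num.sqrt (2 * mu * eps - eps ^+ 2)) / (mu - eps) <= tau
          <= (mu + Num.sqrt (2 * mu * eps - eps ^+ 2)) / (mu - eps))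
  /\
  (forall e : R, 0 < e -> exists K : nat, forall k, (K <= k)%N ->
     enorm (x k.+1 - xstar) <= e * enorm (x k - xstar)).
Proof.
move=> m0 pg cg lg tf mu0 sc /andP[sigma0 sigma1] /andP[gamma0 gamma1] g0 method dN0 xcvg.
have gammaX j : 0 < gamma ^+ j <= 1 by rewrite exprn_gt0// exprn_ile1// ltW.
(* Finiteness at [x k] stays a premise, because the induction that proves it uses this very fact. *)
have sub k (gx : forall i, g i (x k) \is a fin_num) :=
  let: And4 dmin _ _ _ := method k in subobj_minimizer m0 pg cg sc mu0 gx dmin.
have gx k : forall i, g i (x k) \is a fin_num.
  elim: k => // k gx i; have [th [_ gxd _ _]] := sub k gx.
  have [_ _ [j [-> _ _]] ->] := method k.
  by have [] := convex_fun_step (pg i) (cg i) (gx i) (gxd i) (gammaX j).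
pose Fr i k := f i (x k) + fine (g i (x k)).
have iter k : exists th : R, [/\ theta k = th%:E,
    forall i, g i (x k + d k) \is a fin_num,
    forall i, newton_model (f i) (x k) (d k) + fine (g i (x k + d k)) - fine (g i (x k)) <= th,
    forall d' b, (forall i, g i (x k + d') \is a fin_num) ->
      (forall i, newton_model (f i) (x k) d' + fine (g i (x k + d')) - fine (g i (x k)) <= b) ->
      th + mu / 2 * dotv (d' - d k) (d' - d k) <= b &
    th <= - (mu / 2 * dotv (d k) (d k))].
  have [th [thE gxd le_th th_min]] := sub k (gx k).
  exists th; split=> //; first by have [_ -> _ _] := method k.
  have := th_min 0 0; rewrite addr0 sub0r dotvNN.
  rewrite -lerBrDr sub0r; apply=> // i.
  by rewrite newton_model0 add0r subrr.
have armijoE k j th : theta k = th%:E -> (forall i, g i (x k + d k) \is a fin_num) ->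
    armijo f g sigma gamma (x k) (d k) (theta k) j <->
    forall i, f i (x k + gamma ^+ j *: d k) + fine (g i (x k + gamma ^+ j *: d k)) - Fr i k
              <= gamma ^+ j * sigma * th.
  move=> -> gxd.
  have E i : (Fobj f g i (x k + gamma ^+ j *: d k)%R - Fobj f g i (x k))%E =
    (f i (x k + gamma ^+ j *: d k) + fine (g i (x k + gamma ^+ j *: d k)) - Fr i k)%:E.
    have [gxs _] := convex_fun_step (pg i) (cg i) (gx k i) (gxd i) (gammaX j).
    by rewrite [RHS]EFinB !EFinD !fineK.
  by split=> h i; have := h i; rewrite E -EFinM lee_fin.
have descent k i : Fr i k.+1 < Fr i k.
  have [th [thE gxd _ _ th_le]] := iter k.
  have [_ _ [j [tj arm _]] xS] := method k.
  have := (armijoE k j th thE gxd).1 arm i; rewrite -tj -xS -/(Fr i k.+1) => Fr_le.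
  rewrite -subr_lt0; apply: le_lt_trans Fr_le _.
  rewrite pmulr_rlt0; last by rewrite mulr_gt0// tj; case/andP: (gammaX j).
  apply: le_lt_trans th_le _.
  by rewrite oppr_lt0 mulr_gt0 ?divr_gt0// dotv_gt0.
have Fr_mono i k l : (k <= l)%N -> Fr i l <= Fr i k.
  elim: l => [|l IH]; first by rewrite leqn0 => /eqP->.
  rewrite leq_eqVlt ltnS => /orP[/eqP->//|/IH]; exact/le_trans/ltW/descent.
have xc := cvg_enorm xcvg.
(* The tail from [k] on is bounded by [Fr i k], and the bound survives in the limit. *)
have lim i k : g i xstar \is a fin_num /\ f i xstar + fine (g i xstar) <= Fr i k.
  have [df _] := tf i.
  apply: (lsc_limit_le (pg i) (lg i) (differentiable_continuous (df xstar)) xc) => //.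
  by exists k => // l /= kl; exact: Fr_mono.
have gstar i : g i xstar \is a fin_num := (lim i 0%N).1.
(* If x k = xstar then F_i (x k.+1) < F_i (x k) = F_i xstar <= F_i (x k.+1). *)
have xNstar k : x k - xstar != 0.
  rewrite subr_eq0; apply/eqP => xE.
  have := descent k (Ordinal m0); rewrite ltNge => /negP; apply.
  by rewrite {1}/Fr xE; exact: (lim _ _).2.
have near_star r : 0 < r -> exists K, forall k, (K <= k)%N -> `|x k - xstar| < r.
  move=> r0; have [K _ hK] := cvgr_distC_lt _ _ xc _ r0.
  by exists K => k; exact: hK.
(* A step t k < 1 means that t k / gamma was rejected, so that trial point lies outside
   the ball where the models are accurate; but its distance to x k is
   |x k.+1 - x k| / gamma, which tends to 0. *)
have unit_step : exists K, forall k, (K <= k)%N -> t k = 1.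
  have e0 : 0 < (1 - sigma) * mu by rewrite mulr_gt0// subr_gt0.
  have [r r0 err] := newton_model_error_near xstar tf e0.
  (* With both iterates this close to [xstar], the rejected trial point is at distance less than
     [r / 4 + r / 2], even after division by [gamma]. *)
  have gr0 : 0 < gamma * r / 4 by rewrite divr_gt0// mulr_gt0.
  have [K hK] := near_star _ gr0.
  exists K => k Kk; have [_ _ [[|j] [-> _ jmin]] xS] := method k; first by rewrite expr0.
  have [th [thE gxd le_th _ th_le]] := iter k.
  case: (jmin j (ltnSn j)); apply/(armijoE k j th thE gxd) => i.
  apply: (@sufficient_decrease _ _ _ _ mu _ ((1 - sigma) * mu)) => //;
    rewrite ?(ltW mu0) ?(ltW e0) ?lexx ?(ltW sigma1)//.
  apply: err.
    by apply: lt_le_trans (hK _ Kk) _; nra.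
  have -> : x k + gamma ^+ j *: d k - xstar =
      (x k - xstar) + gamma^-1 *: ((x k.+1 - xstar) - (x k - xstar)).
    have -> : x k.+1 - xstar - (x k - xstar) = gamma *: (gamma ^+ j *: d k).
      by rewrite scalerA -exprS xS; apply/rowP => a; rewrite !mxE; ring.
    rewrite scalerK ?gt_eqF//.
    by apply/rowP => a; rewrite !mxE; ring.
  apply: le_lt_trans (ler_normD _ _) _; rewrite normrZ gtr0_norm ?invr_gt0//.
  have h1 := hK _ Kk; have h2 := hK _ (leqW Kk).
  have h3 : gamma^-1 * `|x k.+1 - xstar - (x k - xstar)| < r / 2.
    rewrite ltr_pdivrMl//; apply: le_lt_trans (ler_normB _ _) _; lra.
  have : gamma * r / 4 < r / 4 by rewrite ltr_pM2r// gtr_pMl.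
  lra.
have [K1 hK1] := unit_step.
(* Strong convexity of the subproblem, tested at d' = xstar - x k, together with
   F_i xstar <= F_i (x k.+1). *)
have estimate e : 0 < e -> exists K, forall k, (K <= k)%N ->
    mu * enorm (x k.+1 - xstar) ^+ 2 <=
    e * (enorm (x k - xstar) ^+ 2 + enorm (x k.+1 - x k) ^+ 2).
  move=> e0; have [r r0 err] := newton_model_error_near xstar tf e0.
  have [K2 hK2] := near_star r r0.
  exists (maxn K1 K2) => k; rewrite geq_max => /andP[K1k K2k].
  have [th [thE gxd le_th th_min _]] := iter k.
  have xS : x k.+1 = x k + d k by have [_ _ _ ->] := method k; rewrite hK1// scale1r.
  have dE : x k.+1 - x k = d k by rewrite xS addrC addKr.
  have sE : x k + (xstar - x k) = xstar by rewrite addrC subrK.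
  have pE : xstar - x k - d k = - (x k.+1 - xstar).
    by rewrite xS; apply/rowP => a; rewrite !mxE; ring.
  rewrite !sqr_enorm dE.
  (* The bound adds two model errors to [th]: [e / 2 * S] for the move to [xstar] and [e / 2 * D]
     for the step [d k]. *)
  have := th_min (xstar - x k) (th + e / 2 * (dotv (x k - xstar) (x k - xstar) + dotv (d k) (d k))).
  rewrite sE pE dotvNN => /(_ gstar).
  set S := dotv (x k - xstar) _; set D := dotv (d k) _; set P := dotv (x k.+1 - xstar) _ => main.
  suff /main h : forall i, newton_model (f i) (x k) (xstar - x k) + fine (g i xstar)
      - fine (g i (x k)) <= th + e / 2 * (S + D).
    by clear -h; lra.
  move=> i; have := (lim i k.+1).2; rewrite /Fr xS.
  have := le_th i.
  have := err i (x k) (d k) (hK2 _ K2k) _; rewrite -xS => /(_ (hK2 _ (leqW K2k))).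
  have := err i (x k) (xstar - x k) (hK2 _ K2k); rewrite sE subrr normr0 => /(_ r0).
  rewrite -[in dotv _ _](opprB (x k)) dotvNN -/S -/D xS !ler_norml.
  move=> /andP[] + _ /andP[_].
  move: (newton_model _ _ _) (newton_model _ _ _) (f _ _) (f _ _) (f _ _) (fine _) (fine _) (fine _).
  clear; move: S D => S D *; lra.
have tri k : (enorm (x k.+1 - x k) - enorm (x k - xstar)) ^+ 2 <= enorm (x k.+1 - xstar) ^+ 2.
  rewrite sqr_enorm; apply: le_trans (_ : (enorm (x k.+1 - x k) - enorm (xstar - x k)) ^+ 2 <= _).
    by rewrite -(opprB (x k) xstar) /enorm dotvNN.
  apply: le_trans (sqr_enormB_le _ _) _.
  by rewrite (_ : x k.+1 - x k - (xstar - x k) = x k.+1 - xstar)// opprB addrA subrK.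
split.
  move=> e /andP[e0 e_le]; have [K hK] := estimate e e0.
  (* The successor only makes the threshold positive. *)
  exists K.+1; split=> // k /ltnW /hK est.
  apply: ratio_bounds => //; rewrite ?enorm_gt0 ?enorm_ge0//.
  (* Strictness [e < mu] comes from [sigma > 0]. *)
  rewrite e0; apply: le_lt_trans e_le _; nra.
move=> e e0.
(* Since [T ^+ 2 <= 2 * S ^+ 2 + 2 * P ^+ 2], the estimate becomes [mu * P ^+ 2 <= eps * (3 * S ^+ 2
   + 2 * P ^+ 2)]. The first bound on [eps] absorbs the [P] term into half of the left side; the
   second makes the [S] term at most [e ^+ 2 * mu / 2 * S ^+ 2]. *)
pose eps := Num.min (mu / 4) (e ^+ 2 * mu / 6).
have eps0 : 0 < eps by rewrite lt_min !divr_gt0 ?mulr_gt0 ?exprn_gt0.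
have eps_le1 : eps <= mu / 4 by rewrite ge_min lexx.
have eps_le2 : eps <= e ^+ 2 * mu / 6 by rewrite ge_min lexx orbT.
have [K hK] := estimate eps eps0; exists K => k /hK.
move: (tri k) (enorm_ge0 (x k - xstar)) (enorm_ge0 (x k.+1 - xstar)).
move: (enorm (x k.+1 - x k)) (enorm (x k - xstar)) (enorm (x k.+1 - xstar)) => T S P.
move=> TS S0 P0 est.
rewrite -(@ler_pXn2r _ 2)// ?nnegrE ?mulr_ge0 ?(ltW e0)// exprMn.
have T2 : T ^+ 2 <= 2 * S ^+ 2 + 2 * P ^+ 2 by have := sqr_ge0 (T - 2 * S); lra.
have h1 : mu * P ^+ 2 <= eps * (3 * S ^+ 2 + 2 * P ^+ 2).
  by apply: le_trans est _; rewrite ler_pM2l//; lra.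
have h2 : eps * P ^+ 2 <= mu / 4 * P ^+ 2 by rewrite ler_wpM2r ?sqr_ge0.
have h3 : eps * S ^+ 2 <= e ^+ 2 * mu / 6 * S ^+ 2 by rewrite ler_wpM2r ?sqr_ge0.
rewrite -(ler_pM2l mu0); lra.
Qed.
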